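(* For all positive integers $k$ and $g$, there exists a finite graph $G_{k,g}$ of degeneracy $2$ and girth at least $g$, together with sets $A,B \subseteq V(G_{k,g})$, such that every $(A,B)$-separator in $G_{k,g}$ has at least $k$ vertices, but there do not exist two vertex-disjoint anticomplete $(A,B)$-paths in $G_{k,g}$.
   Context: Graphs are finite and simple. A graph has degeneracy at most $d$ if it can be reduced to the empty graph by successively deleting vertices of degree at most $d$. The girth of a graph is the length of its shortest cycle. A path is a non-empty sequence $v_1,\ldots,v_\ell$ of distinct vertices in which consecutive vertices are adjacent; it is an $(A,B)$-path if $v_1 \in A$ and $v_\ell \in B$. Two paths are anticomplete if there is no edge between a vertex of one and a vertex of the other. A set $S$ is an $(A,B)$-separator if every $(A,B)$-path contains a vertex of $S$. *)

(* Defs.v *)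
From HB Require Import structures.
From mathcomp Require Import all_boot.

Set Implicit Arguments.
Unset Strict Implicit.
Unset Printing Implicit Defensive.

Record sgraph := SGraph {
  vertex :> finType;
  adj : rel vertex;
  adj_sym : symmetric adj;
  adj_irrefl : irreflexive adj
}.

Section Graphs.
Variable G : sgraph.
Implicit Types (A B S : {set G}) (p q c : seq G).

(* The subgraph induced by S can be reduced to the empty graph by successively
   deleting vertices of degree at most d, degrees being taken in the current
   induced subgraph. *)
Inductive reducible (d : nat) : {set G} -> Prop :=
| reducible_empty : reducible d set0
| reducible_delete S (v : G) :
    v \in S -> #|[set u in S | adj v u]| <= d ->
    reducible d (S :\ v) -> reducible d S.

Definition degeneracy_at_most (d : nat) : Prop := reducible d [set: G].

Definition has_degeneracy (d : nat) : Prop :=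
  degeneracy_at_most d /\ forall d', degeneracy_at_most d' -> d <= d'.

(* ucycle alone also holds for [::] and for the traversal [:: u; v] of a
   single edge, hence the size condition. *)
Definition graph_cycle c : bool := (2 < size c) && ucycleb (@adj G) c.

(* Holds for every g when G is acyclic (infinite girth). *)
Definition girth_at_least (g : nat) : Prop :=
  forall c, graph_cycle c -> g <= size c.

Definition graph_path p : bool :=
  [&& p != [::], sorted (@adj G) p & uniq p].

Definition AB_path A B p : bool :=
  graph_path p && (if p is x :: s then (x \in A) && (last x s \in B) else false).

Definition AB_separator A B S : Prop :=
  forall p, AB_path A B p -> exists2 v, v \in p & v \in S.

Definition vertex_disjoint p q : Prop :=
  forall v, v \in p -> v \notin q.

Definition anticomplete p q : Prop :=
  forall u v, u \in p -> v \in q -> ~~ adj u v.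

End Graphs.

(* Main.v *)
Require Import Defs.
From mathcomp Require Import all_boot.
From mathcomp Require Import zify.

(** Take [k.+1] long horizontal paths (rows), the vertex of row [i] in column
    [t] being [(i, t)], and join in each column [m * g] the diagonal vertex
    [(m, m * g)] to the vertices of all other rows.  Let [A] be the set of
    diagonal vertices and [B] the column [0].  The column changes by at most
    one along an edge, so a path from [(j, j * g)] to [B] meets every column
    [i * g] with [i < j], and there every vertex equals or is adjacent to
    [(i, i * g)]: two [(A, B)]-paths always touch.  The rows contain [k.+1]
    disjoint [(A, B)]-paths.  A cycle cannot stay in one column, and its
    extreme columns are multiples of [g], so it meets more than [g] columns. *)

Set Implicit Arguments.
Unset Strict Implicit.
Unset Printing Implicit Defensive.

(** * Degeneracy, cycles and paths in arbitrary graphs *)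

Section SGraphFacts.
Variable G : sgraph.

(** Always delete a vertex of maximal rank among those left: its remaining neighbours have rank at
    most its own, so they are counted by the hypothesis. *)
Lemma degeneracy_at_most_rank (d : nat) (f : G -> nat) :
  (forall v, #|[set u | adj v u & f u <= f v]| <= d) -> degeneracy_at_most G d.
Proof.
move=> fP; rewrite /degeneracy_at_most.
move: {2}#|_| (leqnn #|[set: G]|) => n.
elim: n [set: G] => [|n IHn] S.
  by rewrite leqn0 cards_eq0 => /eqP->; apply: reducible_empty.
have [->|[x xS]] := set_0Vmem S; first by move=> _; apply: reducible_empty.
case: (arg_maxnP f xS) => v /= vS vmax leS; have {}vS : v \in S by [].
apply: (reducible_delete vS); last by apply: IHn; move: leS; rewrite (cardsD1 v) vS.
apply: leq_trans (fP v); apply: subset_leq_card.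
by apply/subsetP=> u; rewrite !inE => /andP[uS ->]; apply: vmax.
Qed.

(** The first deletion takes place in the whole graph, where every degree exceeds [d]; [v0] ensures
    that there is a first deletion. *)
Lemma degeneracy_gt_mindeg (d d' : nat) (v0 : G) :
  (forall v : G, d < #|[set u | adj v u]|) -> degeneracy_at_most G d' -> d < d'.
Proof.
move=> degP; rewrite /degeneracy_at_most; move E: [set: G] => S redS.
case: redS E => [/setP/(_ v0)|{}S v _ led' _ E]; first by rewrite !inE.
apply: leq_trans (degP v) _; apply: leq_trans led'.
by apply: subset_leq_card; apply/subsetP=> u; rewrite -E !inE.
Qed.

Lemma graph_cycle_neighbours (c : seq G) (x : G) :
  graph_cycle c -> x \in c ->
  exists y z, [/\ y \in c, z \in c, y != z, adj x y & adj x z].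
Proof.
case/andP=> szc /andP[cyc uc] xc; case: (rot_to xc) => i [|y p] Ec.
  by move: szc; rewrite -(size_rot i) Ec.
have memc u : (u \in c) = (u \in [:: x, y & p]) by rewrite -Ec mem_rot.
move: cyc uc szc; rewrite -(rot_cycle i) -(rot_uniq i) -(size_rot i) Ec.
case/lastP: p Ec memc => // p z Ec memc cyc uc _.
exists y, z; rewrite !memc !inE !eqxx !orbT; split=> //.
- by rewrite mem_rcons mem_head !orbT.
- by case/and3P: uc => _ + _; rewrite mem_rcons inE negb_or => /andP[].
- by case/andP: cyc.
- by move: cyc; rewrite adj_sym /= rcons_path last_rcons => /and3P[].
Qed.

(** Discrete intermediate value theorem: [f] drops by at most one per step, so it cannot jump over
    [n] on the way down from [x] to [y]. *)
Lemma path_ivt (f : G -> nat) (n : nat) (x y : G) (p : seq G) :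
  (forall u v, adj u v -> f u <= (f v).+1) ->
  path (@adj G) x p -> y \in x :: p -> f y <= n <= f x ->
  exists2 z, z \in x :: p & f z = n.
Proof.
move=> fP; elim: p x => [|x' p IHp] x /=.
  by rewrite inE => _ /eqP-> lenn; exists x; rewrite ?inE //; lia.
case/andP=> exx' px'; rewrite inE => /predU1P[->|yp] /andP[ley lex].
  by exists x; rewrite ?inE ?eqxx //; lia.
have [Ex|neqx] := eqVneq (f x) n; first by exists x; rewrite ?inE ?eqxx.
case: (IHp x' px' yp) => [|z zp fz]; first by have := fP _ _ exx'; lia.
by exists z => //; rewrite inE zp orbT.
Qed.

End SGraphFacts.

(** * The graph and its columns *)

Section StarLadder.
Variables k g : nat.

Let V : finType := ('I_k.+1 * 'I_(k * g).+1)%type.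

Definition ladder_adj : rel V := fun u v =>
  ((u.1 == v.1) && ((u.2 == v.2.+1 :> nat) || (v.2 == u.2.+1 :> nat))) ||
  [&& u.1 != v.1, u.2 == v.2 & (u.2 == u.1 * g :> nat) || (u.2 == v.1 * g :> nat)].

Lemma ladder_adj_sym : symmetric ladder_adj.
Proof.
move=> [i s] [j t]; rewrite /ladder_adj /= [j == i]eq_sym [t == s]eq_sym.
congr (_ && _ || _); first exact: orbC.
by case: (eqVneq s t) => [->|]; rewrite ?andbF //= orbC.
Qed.

Lemma ladder_adj_irrefl : irreflexive ladder_adj.
Proof. by move=> [i s]; rewrite /ladder_adj /= !eqxx /= orbF; lia. Qed.

Definition ladder : sgraph := SGraph ladder_adj_sym ladder_adj_irrefl.

Variant ladder_adj_spec (u v : ladder) : Prop :=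
| LadderRow of u.1 = v.1 & (u.2 = v.2.+1 :> nat \/ v.2 = u.2.+1 :> nat)
| LadderStar of u.1 <> v.1 & u.2 = v.2 & (u.2 = u.1 * g :> nat \/ u.2 = v.1 * g :> nat).

Lemma ladder_adjP (u v : ladder) : reflect (ladder_adj_spec u v) (adj u v).
Proof.
apply: (iffP orP) => [[/andP[/eqP E /orP Ht]|/and3P[/eqP neq /eqP E /orP Ht]]|].
- by apply: LadderRow => //; case: Ht => /eqP; [left|right].
- by apply: LadderStar => //; case: Ht => /eqP; [left|right].
case=> [->|/eqP neq -> Ht]; [move=> Ht; left|right; rewrite neq].
  by rewrite eqxx; case: Ht => ->; rewrite eqxx ?orbT.
by rewrite eqxx; case: Ht => ->; rewrite eqxx ?orbT.
Qed.

Definition column (u : ladder) : nat := u.2.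
Definition diagonal (u : ladder) : bool := u.2 == u.1 * g :> nat.

Lemma ladder_eq (u v : ladder) : u.1 = v.1 :> nat -> column u = column v -> u = v.
Proof. by case: u v => [i s] [j t] /val_inj /= -> /val_inj /= ->. Qed.

Lemma column_adj (u v : ladder) : adj u v -> column u <= (column v).+1.
Proof. by rewrite /column => /ladder_adjP[_|_ ->]; lia. Qed.

Lemma diagonal_ltn (i : 'I_k.+1) : i * g < (k * g).+1.
Proof. by rewrite ltnS leq_mul2r -ltnS ltn_ord orbT. Qed.

Definition diag (i : 'I_k.+1) : ladder := (i, Ordinal (diagonal_ltn i)).

Lemma column_diag_adj (u : ladder) (i : 'I_k.+1) :
  column u = i * g -> u = diag i \/ adj (diag i) u.
Proof.
move=> Eu; have [E|neq] := eqVneq u.1 i; first by left; apply: ladder_eq; rewrite ?E.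
right; apply/ladder_adjP/LadderStar => /=; last by left.
  by move/eqP: neq => neq E; apply: neq.
exact/esym/val_inj.
Qed.

Hypotheses (k_gt0 : 0 < k) (g_gt0 : 0 < g).

(** * Degeneracy exactly two *)

Lemma ladder_degeneracy_at_most2 : degeneracy_at_most ladder 2.
Proof.
(* Columns are deleted from right to left, the diagonal vertex last. *)
apply: (@degeneracy_at_most_rank _ _ (fun u => (column u).*2 + ~~ diagonal u)) => v.
(* The only neighbours that can rank no higher than [v] are its left neighbour [a] and the diagonal
   vertex [b] of its column. *)
pose a : ladder := (v.1, inord (column v).-1).
pose b : ladder := (inord (column v %/ g), v.2).
apply: leq_trans (_ : #|[set a; b]| <= 2); last by rewrite cards2; case: (a != b).
apply: subset_leq_card; apply/subsetP => u; rewrite !inE => /andP[/ladder_adjP].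
have ltv : column v < (k * g).+1 := ltn_ord _.
case=> [E1 E2 lef|neq E Ed lef]; apply/orP; [left|right]; apply/eqP.
  apply: ladder_eq; first by rewrite /= E1.
  rewrite [column a]/column /= inordK; last by lia.
  by case: E2 lef; rewrite /diagonal /column; lia.
(* If [v] were the diagonal vertex of the column instead, then [u] would not be, and the term
   [~~ diagonal u] would make [u] outrank [v]. *)
have {lef}Ed : v.2 = u.1 * g :> nat.
  case: Ed => // Ed; move: lef; rewrite /diagonal /column -E Ed eqxx /=.
  rewrite eqn_pmul2r //; case: eqP => [/val_inj//|_]; lia.
apply: ladder_eq; last by rewrite /column /= E.
by rewrite /b /= [column v]Ed mulnK // inordK.
Qed.

(** Supplies the second neighbour at the two ends of a row, whose columns are multiples of [g]. For
    [u] on the diagonal, any other row serves, and [0 < k] provides one. *)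
Lemma star_neighbour (u : ladder) (m : 'I_k.+1) :
  column u = m * g -> exists2 v, adj u v & column v = column u.
Proof.
move=> Eu; case: (column_diag_adj Eu) => [->|]; last first.
  by rewrite adj_sym => eu; exists (diag m).
pose j : 'I_k.+1 := if m == ord0 then ord_max else ord0.
exists (j, (diag m).2) => //; apply/ladder_adjP/LadderStar => //=; last by left.
rewrite /j; case: eqP => [->|//] /(congr1 val) /= E.
by move: k_gt0; rewrite -E.
Qed.

Lemma ladder_mindeg (v : ladder) : 1 < #|[set u | adj v u]|.
Proof.
have kg_gt0 : 0 < k * g by rewrite muln_gt0 k_gt0.
have ltv : column v < (k * g).+1 := ltn_ord _.
(* The neighbours [y] and [z] lie to the left and to the right of [v], except that a star neighbour
   replaces the missing one at an end of the row. As [0 < k * g], at most one is replaced, so their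
   columns differ. *)
have [y ey ly] : exists2 y, adj v y & column y < column v + (column v == 0).
  have [v0|v_gt0] := posnP (column v).
    case: (@star_neighbour v ord0) => [|y ey Ey]; first by rewrite v0.
    by exists y => //; rewrite Ey v0.
  exists (v.1, inord (column v).-1); last by rewrite {1}/column /= inordK; lia.
  apply/ladder_adjP/LadderRow => //=; left; rewrite inordK; last by lia.
  by rewrite prednK.
have [z ez lz] : exists2 z, adj v z & column v < column z + (column v == k * g).
  have [vk|v_neq] := eqVneq (column v) (k * g).
    case: (@star_neighbour v ord_max) => [//|z ez Ez].
    by exists z => //; rewrite Ez vk; lia.
  exists (v.1, inord (column v).+1); last by rewrite [X in _ < X + _]/column /= inordK; lia.
  by apply/ladder_adjP/LadderRow => //=; right; rewrite inordK //; lia.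
apply/card_gt1P; exists y, z; rewrite !inE; split=> //.
by apply/eqP => Eyz; move: ly lz; rewrite Eyz; lia.
Qed.

Lemma ladder_has_degeneracy2 : has_degeneracy ladder 2.
Proof.
split; first exact: ladder_degeneracy_at_most2.
move=> d'; apply: (degeneracy_gt_mindeg (diag ord0)); exact: ladder_mindeg.
Qed.

(** * Girth *)

Lemma ladder_girth : girth_at_least ladder g.
Proof.
move=> c cycc; have memc := graph_cycle_neighbours cycc.
case: c cycc memc => // x0 c0; set c := x0 :: c0 => cycc memc.
have x0c : (mem c) x0 := mem_head x0 c0.
case: (arg_minnP column x0c) => m mc m_min; case: (arg_maxnP column x0c) => M Mc M_max.
(* Off the multiples of [g] there are only row edges, so the two cycle neighbours of [u] are its
   left and right ones and [u] is not extreme. *)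
have extr u : u \in c -> ~~ (g %| column u) ->
    (exists2 v, v \in c & column v < column u) /\
    (exists2 v, v \in c & column u < column v).
  case/memc=> y [z [yc zc /eqP neq /ladder_adjP ey /ladder_adjP ez]].
  case: ey => [Ey1 Ey2|_ _ Eu]; last by rewrite /column; case: Eu => ->; rewrite dvdn_mull.
  case: ez => [Ez1 Ez2|_ _ Eu]; last by rewrite /column; case: Eu => ->; rewrite dvdn_mull.
  have neq_col : column y <> column z.
    by apply: contra_not neq => /ladder_eq; apply; rewrite -Ey1 Ez1.
  move=> _; have [lt|le] := ltnP (column y) (column z).
    by split; [exists y | exists z] => //; move: lt Ey2 Ez2; rewrite /column; lia.
  by split; [exists z | exists y] => //; move: le neq_col Ey2 Ez2; rewrite /column; lia.
have dvd_m : g %| column m.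
  by apply/negPn/negP => /(extr m mc)[[v /m_min]]; rewrite leqNgt => /negP.
have dvd_M : g %| column M.
  by apply/negPn/negP => /(extr M Mc)[_ [v /M_max]] /= le; rewrite ltnNge le.
have lt_mM : column m < column M.
  rewrite ltnNge; apply/negP => leMm.
  have colc u : u \in c -> column u = column m.
    by move=> uc; have := m_min u uc; have := M_max u uc; lia.
  have star u v : u \in c -> v \in c -> adj u v ->
      u.1 <> v.1 /\ (column m = u.1 * g \/ column m = v.1 * g).
    move=> uc vc /ladder_adjP euv; move: (colc u uc) (colc v vc); rewrite /column.
    by case: euv => [_ Ht|neq _ Ht] Eu Ev; [lia | split=> //; rewrite -Eu].
  (* Two distinct neighbours in the same column force a vertex onto the diagonal. *)
  have dg u : u \in c -> column m = u.1 * g.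
    move=> uc; case: (memc u uc) => y [z [yc zc neq ey ez]].
    have [_ [//|Ey]] := star _ _ uc yc ey; have [_ [//|Ez]] := star _ _ uc zc ez.
    case/eqP: neq; apply: ladder_eq; last by rewrite !colc.
    by apply/eqP; rewrite -(eqn_pmul2r g_gt0) -Ey Ez.
  (* A column has only one diagonal vertex, yet [m] and its neighbour [y] would both be diagonal in
     different rows. *)
  case: (memc m mc) => y [z [yc _ _ ey _]]; have [neq _] := star _ _ mc yc ey.
  by apply/neq/val_inj/eqP; rewrite -(eqn_pmul2r g_gt0) /= -(dg m mc) (dg y yc).
have le_g : g <= column M - column m.
  by apply: dvdn_leq; rewrite ?subn_gt0 // dvdn_sub.
apply: leq_trans (le_g) _.
(* It suffices that each column from that of [m] up to, but excluding, that of [M] is met. Rotating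
   the cycle to start at [M] gives a path descending to [m]. *)
rewrite -[X in X <= _](size_iota (column m)) -(size_map column c).
apply: uniq_leq_size; first exact: iota_uniq.
move=> n; rewrite mem_iota => /andP[le_mn lt_n].
case/andP: cycc => _ /andP[cyc _]; case: (rot_to Mc) => i p Ep.
have mp : m \in M :: p by rewrite -Ep mem_rot.
have Mp : path (@adj ladder) M p.
  by move: cyc; rewrite -(rot_cycle i) Ep /= rcons_path => /andP[].
case: (path_ivt column_adj Mp mp (n := n)) => [|z zp <-]; first by lia.
by apply: map_f; rewrite -(mem_rot i) Ep.
Qed.

(** * Separators and pairs of paths *)

Definition ladderA : {set ladder} := [set u | diagonal u].
Definition ladderB : {set ladder} := [set u | column u == 0].

(** The row is walked leftwards to column [0]. The bound [column u <= n] carries uniqueness through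
    the induction. *)
Lemma row_path (i : 'I_k.+1) (n : nat) : n < (k * g).+1 ->
  exists p : seq ladder,
    [/\ path (@adj ladder) (i, inord n) p, uniq ((i, inord n) :: p),
        column (last (i, inord n) p) = 0
      & forall u, u \in (i, inord n) :: p -> u.1 = i /\ column u <= n].
Proof.
elim: n => [|n IHn] ltn.
  exists [::]; rewrite /= /column inordK //; split=> // u; rewrite inE => /eqP-> /=.
  by rewrite inordK.
have [p [pp up lp rp]] := IHn (ltnW ltn).
exists ((i, inord n) :: p); split=> //.
- rewrite /= pp andbT; apply/ladder_adjP/LadderRow => //=; left.
  by rewrite !inordK // ltnW.
- rewrite cons_uniq up andbT; apply/negP => /rp[_].
  by rewrite /column /= inordK // ltnn.
move=> u; rewrite inE => /predU1P[->|/rp[-> le]]; last by split=> //; apply: leqW.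
by rewrite /column /= inordK.
Qed.

(** [S] meets the path inside each row, so [fst] maps [S] onto all [k.+1] rows. *)
Lemma ladder_separator (S : {set ladder}) : AB_separator ladderA ladderB S -> k < #|S|.
Proof.
move=> sepS; rewrite -[k.+1]card_ord -cardsT.
apply: leq_trans (leq_imset_card fst S); apply: subset_leq_card; apply/subsetP => i _.
have [p [pp up lp rp]] := row_path i (diagonal_ltn i).
case: (sepS ((i, inord (i * g)) :: p)) => [|v vp vS].
  rewrite /AB_path /graph_path /= pp andTb; apply/and3P; split=> //.
    by rewrite inE /diagonal /= inordK ?diagonal_ltn.
  by rewrite inE lp.
by apply/imsetP; exists v => //; case: (rp v vp).
Qed.

Lemma ladder_paths_touch (p q : seq ladder) :
  AB_path ladderA ladderB p -> AB_path ladderA ladderB q ->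
  vertex_disjoint p q -> ~ anticomplete p q.
Proof.
case: p q => [|x p] [|y q]; rewrite /AB_path ?andbF //.
move=> /andP[/and3P[_ /= pp _] /andP[xA xB]] /andP[/and3P[_ /= pq _] /andP[yA yB]].
(* By symmetry [q] starts no further left than [p], so it has to visit the column of [x]. *)
wlog le_xy : x y p q pp pq xA xB yA yB / column x <= column y.
  move=> IH; case/orP: (leq_total (column x) (column y)) => le_xy; first exact: IH le_xy.
  move=> dis anti; apply: (IH y x q p) => // [v vq|u v uq vp].
    by apply/negP => vp; move: (dis v vp); rewrite vq.
  by rewrite adj_sym anti.
move=> dis anti; move: xA yB; rewrite !inE => /eqP xA /eqP yB.
case: (path_ivt column_adj pq (mem_last y q) (n := column x)) => [|z zq Ez].
  by rewrite yB le_xy.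
(* The diagonal vertex [x] dominates its column: either [z = x], against disjointness, or [z] is
   adjacent to [x], against anticompleteness. *)
have Ex : x = diag x.1 by apply: ladder_eq.
case: (@column_diag_adj z x.1); first by rewrite Ez.
  by rewrite -Ex => E; move: (dis x (mem_head _ _)); rewrite -E zq.
by rewrite -Ex; apply/negP/anti => //; apply: mem_head.
Qed.

End StarLadder.

Theorem theorem1p4 (k g : nat) (k_gt0 : 0 < k) (g_gt0 : 0 < g) :
  exists (G : sgraph) (A B : {set G}),
    [/\ has_degeneracy G 2,
        girth_at_least G g,
        forall S : {set G}, AB_separator A B S -> k <= #|S|
      & ~ exists p q : seq G,
            [/\ AB_path A B p, AB_path A B q, vertex_disjoint p q
              & anticomplete p q]].
Proof.
exists (ladder k g), (ladderA k g), (ladderB k g); split.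
- exact: ladder_has_degeneracy2.
- exact: ladder_girth.
- by move=> S /ladder_separator/ltnW.
- by case=> p [q [pP qP dis anti]]; apply: (ladder_paths_touch pP qP dis anti).
Qed.
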